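(* Let $\ell\geqslant 1$ and $h\geqslant 0$ be integers, and let $\Gamma$ be an abelian group of order $16(2\ell+1)(2h+1)$. An $\mathrm{MRS}_\Gamma(2\ell+1, 8; 4h+2)$ exists if and only if $\Gamma$ has more than one involution.
   Context: For an abelian group $(\Gamma,+)$ of order $abc$, a $\Gamma$-magic rectangle set $\mathrm{MRS}_\Gamma(a,b;c)$ is a collection of $c$ arrays of size $a\times b$ whose entries are the elements of $\Gamma$, each element appearing exactly once and in a unique array, such that there are $\omega,\delta\in\Gamma$ with the sum of the entries of every row (of every array) equal to $\omega$ and the sum of the entries of every column (of every array) equal to $\delta$. An involution is an element of order $2$. *)

(* Defs.v *)
From mathcomp Require Import all_boot all_order all_algebra.
Set Implicit Arguments. Unset Strict Implicit. Unset Printing Implicit Defensive.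
Import GRing.Theory.
Local Open Scope ring_scope.

(* A Gamma-magic rectangle set MRS_Gamma(a,b;c): c arrays of size a x b,
   given by f k i j (array k, row i, column j), such that every element of
   Gamma appears exactly once overall (f is a bijection from
   'I_c * 'I_a * 'I_b onto Gamma), all row sums equal omega and all
   column sums equal delta. *)
Definition is_MRS (G : finZmodType) (a b c : nat)
  (f : 'I_c -> 'I_a -> 'I_b -> G) : Prop :=
  bijective (fun t : 'I_c * 'I_a * 'I_b => f t.1.1 t.1.2 t.2) /\
  exists omega delta : G,
    (forall (k : 'I_c) (i : 'I_a), \sum_(j < b) f k i j = omega) /\
    (forall (k : 'I_c) (j : 'I_b), \sum_(i < a) f k i j = delta).

Definition MRS_exists (G : finZmodType) (a b c : nat) : Prop :=
  exists f : 'I_c -> 'I_a -> 'I_b -> G, is_MRS f.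

Definition involutions (G : finZmodType) : {set G} :=
  [set x : G | (x != 0) && (x + x == 0)].

(* Main.v *)
(** If [G] has a unique involution [x], then [x] is the sum of all elements of
    [G]; summing the columns instead shows that this sum is a multiple [n d] of the
    column constant [d] with [n (2l+1) = #|G|], so that [x = (2l+1) x = 0].

    Conversely write [G = S + H] with [#|S| = 16] and [#|H|] odd; [S] is not cyclic.
    Let [Q] be a subgroup of [H] of order [2h+1] and [T] a transversal of [Q] in [H]
    with [T = -T], which is possible because [#|H|] is odd.  The arrays are indexed
    by [(k, q)] with [k < 2] and [q] in [Q], the rows by [T].  Take signs [e_j = 1]
    for the first four columns, [-1] for the last four, and put
      [tau_{e_j x} (k, j) + e_j (x + p_x q)]
    in array [(k, q)], row [x], column [j].  Here each [p_x] is a bijection of [Q]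
    with [sum_x p_x = 0] (all [p_x] are [q] or [-q], except for one [-2q]), and each
    [tau_x] is a bijection of the 16 positions [(k, j)] onto [S] whose sum over every
    half row vanishes.  Column sums force [sum_x tau_x = 0]; since [#|T|] is odd this
    needs three such bijections adding up to zero, the other rows being paired
    off as [a, -a].  The three bijections come from explicit tables, one for each of
    the four noncyclic abelian groups of order 16. *)
Require Import Defs.
From mathcomp Require Import all_boot all_order all_algebra.
From mathcomp Require Import all_fingroup all_solvable zify.

Set Implicit Arguments.
Unset Strict Implicit.
Unset Printing Implicit Defensive.

Import GroupScope GRing.Theory FinRing.Theory.

(** * Subgroups of prescribed order in an abelian group *)

(** Induction on [n]: Cauchy gives [x] in [A] of order the prime [pdiv n], and a subgroup of order
    [n %/ pdiv n] of the quotient by [<[x]>] is pulled back to [A]. *)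
Lemma abelian_subgroup_card (gT : finGroupType) (A : {group gT}) n :
  abelian A -> n %| #|A| -> exists2 B : {group gT}, B \subset A & #|B| = n.
Proof.
elim/ltn_ind: n gT A => n IHn gT A abA dvdn_A.
have n_gt0 : (0 < n)%N by apply: dvdn_gt0 dvdn_A; apply: cardG_gt0.
have [n_le1|n_gt1] := leqP n 1.
  have -> : n = 1%N by apply/eqP; rewrite eqn_leq n_le1.
  by exists 1%G; rewrite ?sub1G ?cards1.
have p_pr := pdiv_prime n_gt1.
have [x Ax ox] := Cauchy p_pr (dvdn_trans (pdiv_dvd n) dvdn_A).
have sXA : <[x]> \subset A by rewrite cycle_subG.
have nXA : <[x]> <| A by rewrite -sub_abelian_normal.
have [|||Bbar sBbar cBbar] := IHn (n %/ pdiv n)%N _ _ (A / <[x]>)%G.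
- by rewrite ltn_Pdiv ?prime_gt1.
- exact: quotient_abelian.
- rewrite card_quotient ?normal_norm // -divgS // -orderE ox.
  by rewrite dvdn_divRL ?divnK ?pdiv_dvd // (dvdn_trans (pdiv_dvd n)).
have [B defB sXB sBA] := inv_quotientS nXA sBbar.
exists B => //.
have nXB : B \subset 'N(<[x]>) by apply: subset_trans sBA (normal_norm nXA).
rewrite -(Lagrange sXB) -card_quotient // -defB cBbar -orderE ox.
by rewrite mulnC divnK ?pdiv_dvd.
Qed.

(** * Tables for the groups of order 16 *)

Local Open Scope nat_scope.

(* Elements of a product of cyclic groups of orders [ns] are coded by the natural
   numbers whose mixed-radix digits, least significant first, are the coordinates. *)
Fixpoint zero_sum (ns : seq nat) (s : seq nat) : bool :=
  if ns is n :: ns' then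
    (n %| sumn [seq (i %% n) | i <- s])
      && zero_sum ns' [seq (i %/ n) | i <- s]
  else true.

(** Position [(k, j)] is entry [8 * k + j], so the blocks of four consecutive entries are the half
    rows. *)
Definition magic_triple (ns a b c : seq nat) : bool :=
  [&& all (fun s => perm_eq s (iota 0 16)) [:: a; b; c],
      all (fun i => zero_sum ns [seq nth 0 s i | s <- [:: a; b; c]]) (iota 0 16)
    & all (fun s => all (fun q => zero_sum ns
        [seq nth 0 s (4 * q + i) | i <- iota 0 4]) (iota 0 4)) [:: a; b; c]].

(* The tables below were found by computer search. *)
Lemma magic_triple_8_2 : magic_triple [:: 8; 2]
  [:: 9; 12; 3; 0; 11; 7; 4; 10; 6; 13; 8; 5; 15; 14; 2; 1]
  [:: 7; 14; 4; 15; 0; 6; 8; 10; 2; 12; 1; 9; 3; 13; 11; 5]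
  [:: 8; 6; 1; 9; 13; 3; 12; 4; 0; 7; 15; 10; 14; 5; 11; 2].
Proof. by vm_compute. Qed.

Lemma magic_triple_4_4 : magic_triple [:: 4; 4]
  [:: 1; 12; 14; 9; 5; 10; 8; 13; 0; 2; 15; 7; 4; 6; 3; 11]
  [:: 8; 9; 6; 13; 11; 4; 10; 15; 7; 1; 2; 14; 0; 5; 12; 3]
  [:: 11; 15; 0; 14; 4; 6; 2; 8; 13; 1; 7; 3; 12; 9; 5; 10].
Proof. by vm_compute. Qed.

Lemma magic_triple_4_2_2 : magic_triple [:: 4; 2; 2]
  [:: 6; 13; 7; 14; 9; 4; 3; 12; 15; 1; 5; 11; 10; 8; 0; 2]
  [:: 0; 10; 11; 3; 8; 13; 1; 6; 12; 4; 15; 5; 14; 7; 2; 9]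
  [:: 6; 5; 14; 15; 3; 11; 0; 10; 1; 7; 8; 12; 4; 13; 2; 9].
Proof. by vm_compute. Qed.

Lemma magic_triple_2_2_2_2 : magic_triple [:: 2; 2; 2; 2]
  [:: 14; 9; 8; 15; 0; 10; 13; 7; 12; 11; 2; 5; 4; 6; 1; 3]
  [:: 1; 4; 0; 5; 6; 8; 13; 3; 11; 14; 9; 12; 10; 7; 2; 15]
  [:: 15; 13; 8; 10; 6; 2; 0; 4; 7; 5; 11; 9; 14; 1; 3; 12].
Proof. by vm_compute. Qed.

(** These lists are the possible types of an abelian group of order 16. Entries divide 16 and there
    are at most four of them, which leaves a finite check. *)
Lemma divisor_chain_16 (ns : seq nat) :
    all [pred m | m > 1] ns -> sorted [rel m n | n %| m] ns ->
    (\prod_(n <- ns) n) = 16 ->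
  ns \in [:: [:: 16]; [:: 8; 2]; [:: 4; 4]; [:: 4; 2; 2]; [:: 2; 2; 2; 2]].
Proof.
move=> ns_gt1 ns_sorted prod_ns.
have mem_ns n : n \in ns -> n \in [:: 2; 4; 8; 16].
  move=> ns_n; have: (n %| 16) by rewrite -prod_ns (big_rem n) //= dvdn_mulr.
  have := allP ns_gt1 n ns_n; rewrite dvdn_divisors //= !inE => n_gt1.
  by case: eqP n_gt1 => [->|].
have size_ns : (size ns <= 4).
  (* All entries are at least 2, so [2 ^ size ns] is at most the product 16. *)
  rewrite -(@leq_exp2l 2) // -[2 ^ 4]prod_ns {mem_ns prod_ns ns_sorted}.
  elim: ns ns_gt1 => [|n ns IH] /=; first by rewrite big_nil.
  by case/andP=> n_gt1 /IH; rewrite big_cons expnS; apply: leq_mul.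
case: ns {ns_gt1} ns_sorted prod_ns mem_ns size_ns => [|a [|b [|c [|d [|]]]]] //=;
  rewrite !(big_cons, big_nil) ?muln1.
- by [].
- by move=> _ -> _ _.
- move=> S P M _; move: (M a) (M b) S P; rewrite !inE !eqxx ?orbT.
  by do 2!(move=> /(_ isT); case/or4P=> /eqP->).
- move=> S P M _; move: (M a) (M b) (M c) S P; rewrite !inE !eqxx ?orbT.
  by do 3!(move=> /(_ isT); case/or4P=> /eqP->).
- move=> S P M _; move: (M a) (M b) (M c) (M d) S P; rewrite !inE !eqxx ?orbT.
  by do 4!(move=> /(_ isT); case/or4P=> /eqP->).
Qed.

Local Open Scope ring_scope.

(** * Subgroups of odd order and symmetric transversals *)

Section AdditiveGroup.

Variable G : finZmodType.
Implicit Types (A H Q S : {group G}) (T : {set G}) (x y : G).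

Lemma group_add0 A : 0 \in A. Proof. exact: (group1 A). Qed.

Lemma group_addN A x : (- x \in A) = (x \in A).
Proof. exact: (groupV A x). Qed.

Lemma group_addD A x y : x \in A -> y \in A -> x + y \in A.
Proof. exact: (@groupM _ A x y). Qed.

Lemma group_addB A x y : x \in A -> y \in A -> x - y \in A.
Proof. by move=> Ax Ay; rewrite group_addD ?group_addN. Qed.

Lemma group_addM A x n : x \in A -> x *+ n \in A.
Proof. exact: (@groupX _ A x n). Qed.

Lemma odd_group_double A x : odd #|A| -> x \in A -> x + x = 0 -> x = 0.
Proof.
move=> oddA Ax x2; have: (#[x] %| 2)%N by rewrite order_dvdn zmodXgE mulr2n x2.
have: odd #[x] by apply: dvdn_odd oddA; apply: order_dvdG.
rewrite dvdn_divisors // !inE => o_x /orP[] /eqP o_eq; last by rewrite o_eq in o_x.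
by apply/eqP; rewrite -[x == 0]order_eq1 o_eq.
Qed.

Lemma odd_group_opp A x : odd #|A| -> x \in A -> x != 0 -> - x != x.
Proof.
move=> oddA Ax; apply: contra => /eqP xx.
by apply/eqP; apply: (odd_group_double oddA Ax); rewrite -{1}xx addNr.
Qed.

Lemma odd_group_double_mem A Q x :
  odd #|A| -> Q \subset A -> x \in A -> x + x \in Q -> x \in Q.
Proof.
move=> oddA sQA Ax Q2x.
have oddx : odd #[x] by apply: dvdn_odd oddA; apply: order_dvdG.
(* [(#[x].+1)./2] is the inverse of 2 modulo the odd order of [x]. *)
have -> : x = (x + x) *+ (#[x].+1)./2.
  have e : (#[x].+1)./2.*2 = #[x].+1.
    by rewrite -[RHS]odd_double_half /= oddx.
  by rewrite -mulr2n -mulrnA mul2n e mulrS (expg_order x : x *+ #[x] = 0) addr0.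
exact: group_addM.
Qed.

(* A symmetric partial transversal of maximal size is complete: otherwise some [z]
   and [- z] could be added, their cosets being distinct because [#|H|] is odd. *)
Lemma symmetric_transversal H Q :
    odd #|H| -> Q \subset H ->
  exists T, [/\ T \subset H, 0 \in T, {in T, forall x, - x \in T},
    {in T &, forall x y, x - y \in Q -> x = y} & (#|T| * #|Q| = #|H|)%N].
Proof.
move=> oddH sQH.
pose P T := [&& T \subset H, 0 \in T, [forall (x | x \in T), - x \in T]
  & [forall (x | x \in T), forall (y | y \in T), (x - y \in Q) ==> (x == y)]].
have P0 : P [set 0].
  apply/and4P; split; rewrite ?sub1set ?group_add0 ?set11 //.
    by apply/forall_inP=> x /set1P->; rewrite oppr0 set11.
  apply/forall_inP=> x /set1P->; apply/forall_inP=> y /set1P->.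
  by rewrite eqxx implybT.
have [T PT maxT] := arg_maxnP (fun T : {set G} => #|T|) P0.
have /and4P[sTH T0 /forall_inP TN TQ] := PT.
have {}TQ : {in T &, forall x y, x - y \in Q -> x = y}.
  move=> x y Tx Ty Qxy; apply/eqP.
  by move/forall_inP: TQ => /(_ x Tx)/forall_inP/(_ y Ty)/implyP; apply.
exists T; split=> //.
(* It remains to show that addition maps [setX T Q] bijectively onto [H]. *)
pose add (u : G * G) := u.1 + u.2.
have add_inj : {in setX T Q &, injective add}.
  move=> [x q] [y r] /setXP[/= Tx Qq] /setXP[/= Ty Qr]; rewrite /add /= => e.
  have exy : x = y.
    apply: TQ => //; have -> : x - y = r - q.
      by apply/eqP; rewrite subr_eq addrAC [r + y]addrC -e addrK.
    exact: group_addB.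
  by move: e; rewrite exy => /addrI->.
rewrite -cardsX -(card_in_imset add_inj); apply: eq_card => z.
apply/imsetP/idP => [[[x q] /setXP[/= Tx Qq] ->]|Hz].
  by apply: group_addD; [apply: (subsetP sTH) | apply: (subsetP sQH)].
have [[x /andP[Tx Qzx]]|nz] :=
  altP (@existsP _ (fun x => (x \in T) && (z - x \in Q))).
  by exists (x, z - x); rewrite ?inE ?Tx // /add /= addrC subrK.
have {}nz x : x \in T -> z - x \notin Q.
  by move=> Tx; apply: contra nz => Qzx; apply/existsP; exists x; rewrite Tx.
have nzN x : x \in T -> - z - x \notin Q.
  by move=> Tx; rewrite -opprD group_addN -[x]opprK nz ?TN.
have nQz : z \notin Q by rewrite -[z]subr0 nz.
have nTz : z \notin T by apply: contraNN (nQz) => /nz; rewrite subrr group_add0.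
have n2z : z + z \notin Q by apply: contra nQz; apply: odd_group_double_mem Hz.
have PU : P (z |: (- z |: T)).
  apply/and4P; split.
  - by rewrite !subUset !sub1set group_addN Hz.
  - by rewrite !inE T0 !orbT.
  - apply/forall_inP=> x; rewrite !inE => /or3P[/eqP->|/eqP->|/TN->]; last 1 first.
    + by rewrite !orbT.
    + by rewrite eqxx orbT.
    + by rewrite opprK eqxx.
  - apply/forall_inP=> x; rewrite !inE => Ux.
    apply/forall_inP=> y; rewrite !inE => Uy; apply/implyP.
    case/or3P: Ux => [/eqP->|/eqP->|Tx]; case/or3P: Uy => [/eqP->|/eqP->|Ty] //.
    + by rewrite opprK (negPf n2z).
    + by rewrite (negPf (nz _ Ty)).
    + by rewrite -opprD group_addN (negPf n2z).
    + by rewrite (negPf (nzN _ Ty)).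
    + by rewrite -opprB group_addN (negPf (nz _ Tx)).
    + by rewrite -opprB group_addN (negPf (nzN _ Tx)).
    + by move=> /(TQ _ _ Tx Ty)->.
suff /negP[] : ~~ (#|z |: (- z |: T)| <= #|T|)%N by apply: maxT.
rewrite -ltnNge; apply: proper_card; apply/properP; split.
  by apply/subsetP=> x Tx; rewrite !inE Tx !orbT.
by exists z; rewrite // !inE eqxx.
Qed.

(* Selects one element of each pair [{x, - x}] with [- x != x]. *)
Definition half x := (enum_rank x < enum_rank (- x))%N.

Lemma halfN x : - x != x -> half (- x) = ~~ half x.
Proof.
move=> nx; rewrite /half opprK -leqNgt ltn_neqAle.
suff -> : nat_of_ord (enum_rank (- x)) != enum_rank x by [].
by apply: contra nx => /eqP e; apply/eqP/enum_rank_inj/val_inj.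
Qed.

(** [half] cuts [U] into two parts exchanged by negation; reindexing one of them matches [F x] with
    [F (- x)]. *)
Lemma sum_opp_pairs (V : zmodType) (U : {set G}) (F : G -> V) :
    {in U, forall x, - x \in U} -> {in U, forall x, - x != x} ->
    {in U, forall x, F x + F (- x) = 0} ->
  \sum_(x in U) F x = 0.
Proof.
move=> UN nU FN; rewrite (bigID half) /=.
rewrite [X in _ + X](reindex_inj (@oppr_inj G)) /=.
rewrite [X in _ + X](eq_bigl (fun x => (x \in U) && half x)) => [|x].
  by rewrite -big_split big1 //= => x /andP[/FN].
have -> : (- x \in U) = (x \in U).
  by apply/idP/idP => /UN //; rewrite opprK.
by case Ux: (x \in U) => //=; rewrite halfN ?nU // negbK.
Qed.

(** * From tables to balanced arrays in a group of order 16 *)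

Fixpoint lincomb (ns : seq nat) (xs : seq G) (i : nat) : G :=
  match ns, xs with
  | n :: ns', x :: xs' => x *+ (i %% n)%N + lincomb ns' xs' (i %/ n)%N
  | _, _ => 0
  end.

(** In each coordinate the digits add up to a multiple of the order of the generator. *)
Lemma lincomb_zero_sum (xs : seq G) (s : seq nat) :
  zero_sum (map order xs) s -> \sum_(i <- s) lincomb (map order xs) xs i = 0.
Proof.
elim: xs s => [|x xs IH] s /=; first by rewrite big1.
move=> /andP[dvd_s /IH]; rewrite big_map big_split /= => ->.
rewrite addr0 sumrMnr.
move: dvd_s; rewrite sumnE big_map => /dvdnP[m ->].
by rewrite mulnC mulrnA (expg_order x : x *+ #[x] = 0) mul0rn.
Qed.

Lemma lincomb_surj (xs : seq G) A s :
    \big[dprod/1%g]_(x <- xs) <[x]> = A -> s \in A ->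
  exists2 i, (i < \prod_(n <- map order xs) n)%N & s = lincomb (map order xs) xs i.
Proof.
elim: xs A s => [|x xs IH] A s /=.
  rewrite !big_nil => <- /set1P ->; exists 0%N => //.
rewrite !big_cons => /dprodP[[_ B _ defB] defA _ _]; rewrite -defA => /mulsgP[y z].
move=> /cycleP[k ->]; rewrite defB => Bz ->.
have [i lt_i ->] := IH _ _ defB Bz.
(* The remainder [k %% #[x]] becomes the least significant digit, below the digits of [i]. *)
exists (k %% #[x] + i * #[x])%N.
  rewrite [X in (_ < X)%N]mulnC; apply: (@leq_trans (i.+1 * #[x])).
    by rewrite mulSn ltn_add2r ltn_mod order_gt0.
  by rewrite leq_mul2r lt_i orbT.
rewrite addnC modnMDl modn_mod divnMDl ?order_gt0 //.
rewrite (divn_small (ltn_pmod _ (order_gt0 x))) addn0.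
by congr (_ + _); rewrite -zmodXgE expg_mod_order.
Qed.

(** The requirement on each [tau x] of the construction; when [#|A| = 16], the 16 distinct entries
    exhaust [A]. *)
Definition balanced (A : {set G}) (a : 'I_2 -> 'I_8 -> G) : Prop :=
  [/\ injective (fun u => a u.1 u.2), forall k j, a k j \in A,
      forall k, \sum_(j < 8 | (j < 4)%N) a k j = 0
    & forall k, \sum_(j < 8 | ~~ (j < 4)%N) a k j = 0].

Lemma balancedN S a : balanced S a -> balanced S (fun k j => - a k j).
Proof.
case=> a_inj aS lo hi; split=> [u v /oppr_inj /a_inj //|k j|k|k].
- by rewrite group_addN.
- by rewrite sumrN lo oppr0.
- by rewrite sumrN hi oppr0.
Qed.

Definition lincomb_array (xs : seq G) (s : seq nat) (k : 'I_2) (j : 'I_8) : G :=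
  lincomb (map order xs) xs (nth 0%N s (8 * k + j)%N).

Lemma lincomb_array_balanced S (xs : seq G) (s : seq nat) :
    \big[dprod/1%g]_(x <- xs) <[x]> = S -> #|S| = 16%N -> perm_eq s (iota 0 16) ->
    all (fun q => zero_sum (map order xs)
      [seq nth 0%N s (4 * q + i)%N | i <- iota 0 4]) (iota 0 4) ->
  balanced S (lincomb_array xs s).
Proof.
move=> defS oS perm_s quads.
have size_s : size s = 16%N by rewrite (perm_size perm_s) size_iota.
pose F i := lincomb (map order xs) xs i.
have prod16 : (\prod_(n <- map order xs) n = 16)%N.
  by rewrite big_map -oS -(bigdprod_card defS).
(* Decoding is onto [S], hence injective on the 16 codes by cardinality. *)
have SF : [set F i | i : 'I_16] = S.
  apply/esym/eqP; rewrite eqEcard; apply/andP; split.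
    apply/subsetP=> x Sx; have [i] := lincomb_surj defS Sx; rewrite prod16 => lt_i ->.
    by apply/imsetP; exists (Ordinal lt_i).
  by rewrite oS (leq_trans (leq_imset_card _ _)) // card_ord.
have F_inj : injective (fun i : 'I_16 => F i).
  have /imset_injP inj : #|[set F i | i : 'I_16]| == #|'I_16|.
    by rewrite SF oS card_ord.
  by move=> i j; apply: inj.
have lt_nth i : (i < 16)%N -> (nth 0%N s i < 16)%N.
  move=> lt_i; have := mem_nth 0%N (_ : (i < size s)%N); rewrite size_s => /(_ lt_i).
  by rewrite (perm_mem perm_s) mem_iota.
have lt_idx (k : 'I_2) (j : 'I_8) : (8 * k + j < 16)%N.
  by case: k j => [[|[|]] //= _] [] [|[|[|[|[|[|[|[|]]]]]]]].
have sum_quad q : (q < 4)%N -> \sum_(i < 4) F (nth 0%N s (4 * q + i)%N) = 0.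
  move=> lt_q; have /lincomb_zero_sum : zero_sum (map order xs)
      [seq nth 0%N s (4 * q + i)%N | i <- iota 0 4].
    by apply: (allP quads); rewrite mem_iota.
  by rewrite big_map -(big_mkord xpredT (fun i => F (nth 0%N s (4 * q + i)%N))).
have lo k : \sum_(j < 8 | (j < 4)%N) lincomb_array xs s k j = 0.
  rewrite -(big_ord_widen 8 (fun j => F (nth 0%N s (8 * k + j)%N))) //.
  by have := @sum_quad (2 * k)%N; rewrite mulnA => -> //; case: k => [[|[|]]].
split=> //.
- move=> [k j] [k' j'] /= /(F_inj (Ordinal (lt_nth _ (lt_idx k j)))
    (Ordinal (lt_nth _ (lt_idx k' j')))) /(congr1 val) /= /eqP.
  rewrite nth_uniq ?size_s // ?(perm_uniq perm_s) ?iota_uniq // => /eqP e.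
  have ek : k = k' :> nat.
    move: (congr1 (divn^~ 8) e); rewrite /= ![(8 * _)%N]mulnC !divnMDl //.
    by rewrite !divn_small // !addn0.
  rewrite (val_inj ek); congr (_, _).
  by apply: val_inj; apply/eqP; move/eqP: e; rewrite ek eqn_add2l.
- move=> k j; rewrite -SF; apply/imsetP.
  by exists (Ordinal (lt_nth _ (lt_idx k j))).
(* The whole row consists of the blocks [2 * k] and [(2 * k).+1]; removing the left half leaves the
   right one. *)
- move=> k; have: \sum_(j < 8) lincomb_array xs s k j = 0.
    rewrite (@big_split_ord _ _ _ 4 4) /=.
    under eq_bigr do rewrite /lincomb_array /=.
    under [X in _ + X]eq_bigr do rewrite /lincomb_array /= addnA.
    have := @sum_quad (2 * k)%N; have := @sum_quad (2 * k).+1%N.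
    rewrite mulnS mulnA addnC /F => -> ; last by case: k => [[|[|]]].
    by move=> ->; rewrite ?addr0 //; case: k => [[|[|]]].
  by rewrite (bigID (fun j : 'I_8 => (j < 4)%N)) /= lo add0r.
Qed.

(** By the structure theorem [S] is a direct product of cyclic groups whose orders form one of five
    lists; four have a table, and [[:: 16]] would make [S] cyclic. *)
Lemma balanced_triple S :
    #|S| = 16%N -> ~~ cyclic S ->
  exists a b c, [/\ balanced S a, balanced S b, balanced S c
    & forall k j, a k j + b k j + c k j = 0].
Proof.
move=> oS ncS; have [xs defS ordS] := abelian_structure (zmod_abelian S).
have [a [b [c abc]]] : exists a b c, magic_triple (map order xs) a b c.
  have := @divisor_chain_16 (map order xs).
  rewrite {1 2}ordS abelian_type_gt1 abelian_type_dvdn_sorted.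
  rewrite big_map (bigdprod_card defS) !inE => /(_ isT isT oS).
  case/or4P=> [/eqP e|/eqP->|/eqP->|/orP[/eqP->|/eqP->]]; last 4 first.
  - by do 3 eexists; apply: magic_triple_8_2.
  - by do 3 eexists; apply: magic_triple_4_4.
  - by do 3 eexists; apply: magic_triple_4_2_2.
  - by do 3 eexists; apply: magic_triple_2_2_2_2.
  case: xs e defS {ordS} => [|x [|y xs]] // _ /=; rewrite big_seq1 => defS.
  by rewrite -defS cycle_cyclic in ncS.
case/and3P: abc => /and4P[pa pb pc _] sum0 /and4P[qa qb qc _].
exists (lincomb_array xs a), (lincomb_array xs b), (lincomb_array xs c).
split; try exact: lincomb_array_balanced.
move=> k j; have/(allP sum0)/lincomb_zero_sum : (8 * k + j)%N \in iota 0 16.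
  by rewrite mem_iota; case: k j => [[|[|]] //= _] [] [|[|[|[|[|[|[|[|]]]]]]]].
by rewrite !big_cons big_nil addr0 addrA.
Qed.

(** * Involutions and cyclic subgroups *)

Lemma involutionE x : (x \in involutions G) = (#[x] == 2)%N.
Proof.
rewrite inE; apply/andP/eqP => [[nx0 /eqP x2]|ox].
  by apply/prime_nt_dvdP; rewrite // ?order_eq1 // order_dvdn zmodXgE mulr2n x2.
rewrite -[x == 0]order_eq1 ox; split=> //.
by rewrite -mulr2n -zmodXgE -ox expg_order.
Qed.

(** A cyclic group has at most one subgroup of order 2, so two involutions would generate the same
    one. *)
Lemma cyclic_involutions S :
  cyclic S -> involutions G \subset S -> (#|involutions G| <= 1)%N.
Proof.
move=> cS /subsetP sIS; rewrite leqNgt; apply/card_gt1P => [[u [v [Iu Iv nuv]]]].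
have [Su Sv] := (sIS _ Iu, sIS _ Iv).
move: Iu Iv; rewrite !involutionE => /eqP ou /eqP ov.
have /eqP uv : <[u]> :==: <[v]>.
  by rewrite (eq_subG_cyclic cS) ?cycle_subG // -!orderE ou ov.
have : u \in <[v]> by rewrite -uv cycle_id.
rewrite (cycle2g ov) !inE (negPf nuv) orbF => /eqP u1.
by move: ou; rewrite u1 order1.
Qed.

(** * Construction of the rectangle set *)

(** Serves for both parts of the column sums: the terms at [0], [y], [- y] cancel together, the
    others in pairs. *)
Lemma sum_symmetric_transversal T y (F : G -> G) :
    0 \in T -> y \in T -> {in T, forall x, - x \in T} ->
    {in T, forall x, x != 0 -> - x != x} -> y != 0 ->
    F 0 + F y + F (- y) = 0 ->
    {in T, forall x, x != 0 -> x != y -> x != - y -> F x + F (- x) = 0} ->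
  \sum_(x in T) F x = 0.
Proof.
move=> T0 Ty TN nT ny F0 FN.
pose Y : {set G} := 0 |: (y |: [set - y]).
have sYT : Y \subset T by rewrite !subUset !sub1set T0 Ty TN.
have YN x : (- x \in Y) = (x \in Y).
  by rewrite !inE oppr_eq0 eqr_oppLR eqr_opp [(x == - y) || _]orbC.
rewrite (big_setID Y) /= (setIidPr sYT).
rewrite big_setU1 ?big_setU1 ?big_set1 /= => [||]; last first.
- by rewrite !inE ![0 == _]eq_sym oppr_eq0 (negPf ny).
- by rewrite inE eq_sym nT.
rewrite addrA F0 add0r; apply: sum_opp_pairs => x /setDP[Tx nYx].
- by rewrite in_setD YN nYx TN.
- by apply: nT => //; apply: contraNneq nYx => ->; rewrite !inE eqxx.
- by move: nYx; rewrite !inE => /norP[nx0 /norP[nxy nxNy]]; apply: FN.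
Qed.

(** Allows arrays indexed by any finite type; injectivity suffices because the cardinalities
    agree. *)
Lemma MRS_exists_of_injective (K : finType) (a b c : nat)
    (f : K -> 'I_a -> 'I_b -> G) (omega delta : G) :
    #|K| = c -> #|G| = (a * b * c)%N ->
    injective (fun t : K * 'I_a * 'I_b => f t.1.1 t.1.2 t.2) ->
    (forall k i, \sum_(j < b) f k i j = omega) ->
    (forall k j, \sum_(i < a) f k i j = delta) ->
  MRS_exists G a b c.
Proof.
move=> <- oG f_inj rows cols; exists (fun k => f (enum_val k)); split; last first.
  by exists omega, delta; split=> k; [apply: rows | apply: cols].
apply: inj_card_bij => [[[k i] j] [[k' i'] j'] /= e|].
  by have [/enum_val_inj-> -> ->] := f_inj (_, i, j) (_, i', j') e.
by rewrite oG !card_prod !card_ord mulnC mulnA.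
Qed.

Lemma MRS_exists_of_transversal S H Q T y a b c :
    (forall x, x \in S -> x \in H -> x = 0) -> odd #|H| -> Q \subset H ->
    T \subset H -> 0 \in T -> {in T, forall x, - x \in T} ->
    {in T &, forall x y, x - y \in Q -> x = y} ->
    y \in T -> y != 0 -> half y ->
    balanced S a -> balanced S b -> balanced S c ->
    (forall k j, a k j + b k j + c k j = 0) ->
    #|G| = (#|T| * 8 * (2 * #|Q|))%N ->
  MRS_exists G #|T| 8 (2 * #|Q|).
Proof.
move=> SH oddH sQH sTH T0 TN TQ Ty ny hy ba bb bc abc oG.
have nT : {in T, forall x, x != 0 -> - x != x}.
  by move=> x Tx; apply: odd_group_opp oddH (subsetP sTH _ Tx).
have nyN : - y != y by apply: nT.
(* The triple sits at [0], [y], [- y]; every other opposite pair carries [a] and [- a]. *)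
pose tau x := if x == 0 then a else if x == y then b else if x == - y then c
  else if half x then a else fun k j => - a k j.
(* At [0], [y], [- y] the values are [q], [q], [- (q + q)], using [half y]; at other opposite pairs
   they are [q] and [- q]. *)
pose p x q : G := if x == - y then - (q + q)
  else if (x == 0) || half x then q else - q.
pose sg (j : 'I_8) (v : G) := if (j < 4)%N then v else - v.
have tau_bal x : balanced S (tau x).
  by rewrite /tau; do 4?case: ifP => // _; apply: balancedN.
have tau0 : tau 0 = a by rewrite /tau eqxx.
have tauy : tau y = b by rewrite /tau (negPf ny) eqxx.
have tauNy : tau (- y) = c by rewrite /tau oppr_eq0 (negPf ny) (negPf nyN) eqxx.
have pQ x q : q \in Q -> p x q \in Q.
  by move=> Qq; rewrite /p; do 2?case: ifP => _; rewrite ?group_addN ?group_addD.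
have p_inj x : {in Q &, injective (p x)}.
  move=> q r Qq Qr; rewrite /p; do 2?case: ifP => _ //; last exact: oppr_inj.
  (* Doubling is injective on [Q], a subgroup of the odd-order group [H]. *)
  move/oppr_inj => e; apply/eqP; rewrite -subr_eq0; apply/eqP.
  apply: (odd_group_double oddH); first by rewrite (subsetP sQH) ?group_addB.
  by rewrite addrACA -opprD e subrr.
have sgK j : involutive (sg j).
  by move=> v; rewrite /sg; case: (j < 4)%N; rewrite ?opprK.
have sgD j u v : sg j (u + v) = sg j u + sg j v.
  by rewrite /sg; case: ifP => // _; rewrite opprD.
have sum_sg v : \sum_(j < 8) sg j v = 0.
  rewrite !big_ord_recl big_ord0.
  change (v + (v + (v + (v + (- v + (- v + (- v + (- v + 0))))))) = 0).
  by rewrite addr0 !addrA !addrK subrr.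
have sgQ j q : q \in Q -> sg j q \in Q.
  by rewrite /sg; case: ifP; rewrite ?group_addN.
have sgT j x : x \in T -> sg j x \in T.
  by rewrite /sg; case: ifP => // _ /TN.
(* [tau] is indexed by [sg j x] because this, not [x], can be read off the [H] part of an entry;
   each column still meets every [tau x] with [x] in [T] once. *)
pose f (K : 'I_2 * 'I_#|Q|) (i : 'I_#|T|) (j : 'I_8) :=
  tau (sg j (enum_val i)) K.1 j + sg j (enum_val i + p (enum_val i) (enum_val K.2)).
have sumT : forall F : G -> G, F 0 + F y + F (- y) = 0 ->
    {in T, forall x, x != 0 -> x != y -> x != - y -> F x + F (- x) = 0} ->
    \sum_(x in T) F x = 0.
  by move=> F; apply: sum_symmetric_transversal.
have sum_tau k j : \sum_(x in T) tau x k j = 0.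
  apply: sumT => [|x Tx nx0 nxy nxNy]; first by rewrite tau0 tauy tauNy abc.
  rewrite /tau oppr_eq0 eqr_oppLR eqr_opp (negPf nx0) (negPf nxy) (negPf nxNy).
  by rewrite halfN ?nT //; case: ifP => _ /=; rewrite ?subrr ?addNr.
have sum_p q : \sum_(x in T) (x + p x q) = 0.
  apply: sumT => [|x Tx nx0 nxy nxNy].
    rewrite /p eqxx [0 == - y]eq_sym [y == - y]eq_sym oppr_eq0 (negPf ny).
    by rewrite (negPf nyN) eqxx hy /= add0r [q + (y + q)]addrCA addrACA subrr add0r subrr.
  rewrite /p eqr_opp oppr_eq0 (negPf nx0) (negPf nxy) (negPf nxNy) /=.
  rewrite halfN ?nT // addrACA subrr add0r.
  by case: ifP => _ /=; rewrite ?subrr ?addNr.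
apply: (@MRS_exists_of_injective _ _ _ _ f 0 0) => //.
- by rewrite card_prod !card_ord.
(* An entry is peeled: [S] and [H] meet trivially, which isolates the [tau] part; the rest modulo
   [Q] gives [sg j x]; then [tau (sg j x)] gives [(k, j)], hence [x], and [p x] gives [q]. *)
- move=> [[[k q] i] j] [[[k' q'] i'] j'] /= e.
  have [x_T Qq] := (enum_valP i, enum_valP q).
  have [x'_T Qq'] := (enum_valP i', enum_valP q').
  move: e; rewrite /f /=; set x := enum_val i; set x' := enum_val i'.
  rewrite -/x in x_T; rewrite -/x' in x'_T.
  set r := enum_val q; set r' := enum_val q'.
  rewrite -/r in Qq; rewrite -/r' in Qq'.
  rewrite !sgD => e.
  have memH v s z : z \in T -> s \in Q -> sg v z + sg v (p z s) \in H.
    move=> Tz Qs; apply: group_addD; first by rewrite (subsetP sTH) ?sgT.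
    by rewrite (subsetP sQH) ?sgQ ?pQ.
  have [_ tS _ _] := tau_bal (sg j x); have [_ tS' _ _] := tau_bal (sg j' x').
  have eS : tau (sg j x) k j = tau (sg j' x') k' j'.
    apply/eqP; rewrite -subr_eq0; apply/eqP/SH; first exact: group_addB.
    have -> : tau (sg j x) k j - tau (sg j' x') k' j' =
        sg j' x' + sg j' (p x' r') - (sg j x + sg j (p x r)).
      by apply/eqP; rewrite subr_eq addrAC eq_sym subr_eq e addrC.
    by rewrite group_addB ?memH.
  move: e; rewrite eS => /addrI e.
  have ex : sg j x = sg j' x'.
    apply: TQ; rewrite ?sgT //.
    have -> : sg j x - sg j' x' = sg j' (p x' r') - sg j (p x r).
      by apply/eqP; rewrite subr_eq addrAC eq_sym subr_eq e addrC.
    by rewrite group_addB ?sgQ ?pQ.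
  have [t_inj _ _ _] := tau_bal (sg j x).
  have [ek ej] : (k, j) = (k', j').
    by apply: t_inj; rewrite /= eS ex.
  move: ex e; rewrite -{}ej -{}ek => /(can_inj (sgK j)) ex.
  rewrite -ex => /addrI/(can_inj (sgK j))/(p_inj _ _ _ Qq Qq')/enum_val_inj->.
  by rewrite (enum_val_inj ex).
- move=> [k q] i; rewrite /f /= big_split /=; set x := enum_val i.
  (* The left half uses [tau x], the right half [tau (- x)], and each half sums to 0. *)
  rewrite (bigID (fun j : 'I_8 => (j < 4)%N)) /=.
  rewrite (eq_bigr (fun j => tau x k j)) => [|j lt_j]; last by rewrite /sg lt_j.
  rewrite [X in _ + X + _](eq_bigr (fun j => tau (- x) k j)) => [|j /negPf lt_j].
    have [_ _ -> _] := tau_bal x; have [_ _ _ ->] := tau_bal (- x).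
    by rewrite !add0r sum_sg.
  by rewrite /sg lt_j.
- move=> [k q] j; rewrite /f /= -(big_enum_val
    (fun x => tau (sg j x) k j + sg j (x + p x (enum_val q)))) big_split /=.
  have -> : \sum_(x in T) tau (sg j x) k j = 0.
    (* [sg j] permutes [T]. *)
    rewrite (reindex_inj (can_inj (sgK j))) /=; under eq_bigr do rewrite sgK.
    rewrite (eq_bigl (mem T)) ?sum_tau // => x.
    by apply/idP/idP => /(sgT j) //; rewrite sgK.
  rewrite add0r /sg; case: (j < 4)%N; first exact: sum_p.
  by rewrite sumrN sum_p oppr0.
Qed.

End AdditiveGroup.

(** * The sum of all elements, and the equivalence *)

(** Apart from [0] and [x], all elements cancel against their negatives. *)
Lemma sum_unique_involution (G : finZmodType) (x : G) :
  involutions G = [set x] -> \sum_(g : G) g = x.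
Proof.
move=> defI; have invE g : (g \in involutions G) = (g == x) by rewrite defI inE.
have [nx0 Nx] : x != 0 /\ - x = x.
  have: x \in involutions G by rewrite invE.
  rewrite inE => /andP[nx0 /eqP x2]; split=> //.
  by apply/eqP; rewrite eq_sym -addr_eq0 x2.
pose I : {set G} := [set 0; x].
have -> : \sum_(g : G) g = \sum_(g in [set: G]) g by apply: eq_bigl => g; rewrite inE.
rewrite (big_setID I) /= setTI big_setU1 ?big_set1 ?inE 1?eq_sym //= add0r.
rewrite sum_opp_pairs ?addr0 // => g; last by rewrite subrr.
  by rewrite !inE oppr_eq0 eqr_oppLR Nx.
rewrite !inE andbT => /norP[ng0 ngx]; apply: contra ngx => /eqP Ng.
by rewrite -invE inE ng0 -{1}Ng addNr /=.
Qed.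

Theorem theorem1p8 (G : finZmodType) (l h : nat) :
  (1 <= l)%N ->
  #|G| = (16 * (2 * l + 1) * (2 * h + 1))%N ->
  MRS_exists G (2 * l + 1) 8 (4 * h + 2) <-> (1 < #|involutions G|)%N.
Proof.
move=> l_gt0 oG; have oT : #|[set: G]| = #|G| by rewrite cardsT.
split=> [[f [f_bij [omega [delta [_ cols]]]]]|I_gt1].
  rewrite ltnNge; apply/negP => I_le1.
  have [x _ ox] : {x | x \in [set: G]%G & #[x] = 2%N}.
    by apply: Cauchy; rewrite // oT oG !dvdn_mulr.
  have Ix : x \in involutions G by rewrite involutionE ox.
  have defI : involutions G = [set x].
    by apply/esym/eqP; rewrite eqEcard sub1set Ix cards1.
  (* Each array contributes [delta *+ 8]; the factor [2 * l + 1] completes the multiple of [delta]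
     to [#|G|]. *)
  have : x *+ (2 * l + 1) = 0.
    rewrite -(sum_unique_involution defI) (reindex _ (onW_bij _ f_bij)) /=.
    rewrite -(pair_bigA _ (fun (u : 'I_(4 * h + 2) * 'I_(2 * l + 1)) j => f u.1 u.2 j)) /=.
    rewrite -(pair_bigA _ (fun k i => \sum_j f k i j)) /=.
    rewrite (eq_bigr (fun _ => delta *+ 8)) => [|k _]; last first.
      rewrite exchange_big /= (eq_bigr (fun _ => delta)) => [|j _]; last exact: cols.
      by rewrite sumr_const card_ord.
    rewrite sumr_const card_ord -!mulrnA.
    have -> : (8 * ((4 * h + 2) * (2 * l + 1)) = #|G|)%N.
      by rewrite oG; lia.
    by rewrite -oT -zmodXgE expg_cardG ?inE.
  (* As [x] has order 2, its odd multiple is [x] itself. *)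
  rewrite mulrnDr mulrnA -[x *+ 2]zmodXgE -ox expg_order mul0rn add0r => x0.
  by move: ox; rewrite [x]x0 order1.
have odd1 n : odd (2 * n + 1) by rewrite addn1 /= mul2n odd_double.
have oddm : odd ((2 * l + 1) * (2 * h + 1)) by rewrite oddM !odd1.
have [S _ oS] : exists2 S : {group G}, S \subset [set: G]%G & #|S| = 16%N.
  apply: abelian_subgroup_card; first exact: zmod_abelian.
  by rewrite oT oG -mulnA dvdn_mulr.
have [H _ oH] : exists2 H : {group G}, H \subset [set: G]%G
    & #|H| = ((2 * l + 1) * (2 * h + 1))%N.
  apply: abelian_subgroup_card; first exact: zmod_abelian.
  by rewrite oT oG -mulnA dvdn_mull.
have [Q sQH oQ] : exists2 Q : {group G}, Q \subset H & #|Q| = (2 * h + 1)%N.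
  apply: abelian_subgroup_card; first exact: zmod_abelian.
  by rewrite oH dvdn_mull.
have oddH : odd #|H| by rewrite oH.
have tiSH : S :&: H = 1%g.
  by apply: coprime_TIg; rewrite oS oH (@coprime_pexpl 4 2) // coprime2n.
have SH x : x \in S -> x \in H -> x = 0.
  by move=> Sx Hx; apply/set1P; rewrite -[[set _]]tiSH inE Sx.
have defG : (S * H)%g = [set: G].
  by apply/eqP; rewrite eqEcard subsetT TI_cardMg // oS oH cardsT oG mulnA /=.
(* For an involution [s + t], the element [t + t = - (s + s)] lies in both [S] and [H], so it
   vanishes, and [t = 0] by oddness. *)
have sIS : involutions G \subset S.
  apply/subsetP=> x; rewrite inE => /andP[_ /eqP x2].
  have /mulsgP[s t Ss Ht xst] : x \in (S * H)%g by rewrite defG inE.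
  rewrite zmodMgE in xst.
  have t2 : t + t = 0.
    apply: SH; last exact: group_addD.
    have -> : t + t = - (s + s).
      by apply/eqP; rewrite -addr_eq0 addrACA [t + s]addrC -xst x2.
    by rewrite group_addN group_addD.
  by rewrite xst (odd_group_double oddH Ht t2) addr0.
have ncS : ~~ cyclic S.
  by apply: contraL I_gt1 => cS; rewrite -leqNgt (cyclic_involutions cS sIS).
have [a [b [c [ba bb bc abc]]]] := balanced_triple oS ncS.
have [T [sTH T0 TN TQ cardT]] := symmetric_transversal oddH sQH.
have {}cardT : #|T| = (2 * l + 1)%N.
  by apply/eqP; rewrite -(@eqn_pmul2r #|Q|) ?cardG_gt0 // cardT oH oQ.
(* [l >= 1] gives [T] a nonzero element; [half] selects it or its negative. *)
have [y [Ty ny hy]] : exists y, [/\ y \in T, y != 0 & half y].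
  have [x Tx nx] : exists2 x, x \in T & x != 0.
    have /card_gt1P[x [z [Tx Tz]]] : (1 < #|T|)%N by rewrite cardT addn1 ltnS muln_gt0.
    have [-> nz|nx _] := eqVneq x 0; last by exists x.
    by exists z => //; rewrite eq_sym.
  have [hx|nhx] := boolP (half x); first by exists x.
  exists (- x); rewrite TN // oppr_eq0 nx halfN //.
  by apply: odd_group_opp oddH _ nx; apply: (subsetP sTH).
have -> : (4 * h + 2 = 2 * #|Q|)%N by rewrite oQ mulnDr mulnA.
rewrite -cardT.
apply: (MRS_exists_of_transversal SH oddH sQH sTH T0 TN TQ Ty ny hy ba bb bc abc).
by rewrite oG cardT oQ; lia.
Qed.
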